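(* For the Power Dominating Set problem restricted to planar graphs, the algorithm described in the context, run on a tree decomposition of the input planar graph of width $O(\sqrt{n})$, achieves an approximation guarantee of $O(\sqrt{n})$, where $n$ is the number of nodes.
   Context: Power domination: for an undirected graph $G=(V,E)$ and $S\subseteq V$, $\mathcal{P}_S$ is obtained by (Rule 1) putting every node of $S$ and every neighbor of a node of $S$ into $\mathcal{P}_S$, and (Rule 2) repeatedly: if $v\in\mathcal{P}_S$ and all neighbors of $v$ except exactly one neighbor $w$ are in $\mathcal{P}_S$, insert $w$. $S$ power dominates $G$ if $\mathcal{P}_S=V$; the PDS problem asks for a minimum-size such $S$. For $R\subseteq V$, $nbr(R)=\{v\in V\setminus R: v$ adjacent to some $u\in R\}$; $R$ is an $S$-strong region if $R\not\subseteq\mathcal{P}_{S\cup nbr(R)}$. A tree decomposition of $G$ is a pair $\langle\{X_i: i\in I\},T\rangle$ where $T$ is a tree on node set $I$, each $X_i\subseteq V$ (a bag), $\bigcup_i X_i=V$, every edge has both ends in some bag, and whenever $j$ lies on the path from $i$ to $k$ in $T$ we have $X_i\cap X_k\subseteq X_j$; its width is $\max_i|X_i|-1$. It is known that an $n$-node planar graph has a tree decomposition of width $O(\sqrt n)$ computable in $O(n^{3/2})$ time. Algorithm: root $T$ at $r$; let $d$ be the maximum distance from $r$ in $T$. Set $S=\emptyset$. For $\ell=d,\dots,0$ and each $T$-node $q$ at distance $\ell$ from $r$: let $Y_q$ be the union of the bags in the subtree rooted at $q$; if $Y_q$ is an $S$-strong region, set $S\leftarrow S\cup X_q$. Output $S$.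 *)

(* Defs.v *)
From HB Require Import structures.
From mathcomp Require Import all_boot all_order all_algebra.
From mathcomp Require Import all_classical all_reals topology normedtype landau.
Set Implicit Arguments.
Unset Strict Implicit.
Unset Printing Implicit Defensive.
Import Order.TTheory GRing.Theory Num.Theory numFieldNormedType.Exports.

Record graph : Type := Graph {
  vertex :> finType;
  edge : rel vertex;
  edge_sym : symmetric edge;
  edge_irr : irreflexive edge }.

Arguments edge {g}.

Section Planarity.
Local Open Scope ring_scope.

(* A drawing of G in the plane: vertices are distinct points, and the edge uv is
   the simple arc [arc u v], parametrised by [0, 1] from u to v. *)
Record plane_drawing (R : realType) (G : graph)
    (pt : G -> R * R) (arc : G -> G -> R -> R * R) : Prop := PlaneDrawing {
  pt_inj : injective pt;
  arc_continuous : forall u v, edge u v ->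
    {within `[0, 1]%classic, continuous (arc u v)}%classic;
  arc_inj : forall u v, edge u v -> {in `[0, 1] &, injective (arc u v)};
  arc_start : forall u v, edge u v -> arc u v 0 = pt u;
  arc_end : forall u v, edge u v -> arc u v 1 = pt v;
  arc_rev : forall u v, edge u v -> forall t : R, t \in `[0, 1] ->
    arc v u t = arc u v (1 - t);
  arc_avoids_points : forall u v, edge u v ->
    forall (x : G) (t : R), t \in `]0, 1[ -> arc u v t <> pt x;
  arcs_disjoint : forall u v x y, edge u v -> edge x y ->
    [set u; v] != [set x; y] :> {set G} ->
    forall s t : R, s \in `]0, 1[ -> t \in `]0, 1[ -> arc u v s <> arc x y t }.

Definition planar (R : realType) (G : graph) : Prop :=
  exists (pt : G -> R * R) (arc : G -> G -> R -> R * R), plane_drawing pt arc.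

End Planarity.

Section PowerDomination.
Variable G : graph.
Implicit Types (S P : {set G}) (v : G).

Definition nbr S : {set G} :=
  [set v in ~: S | [exists u in S, edge u v]].

Definition rule1 S : {set G} := S :|: nbr S.

(* One simultaneous round of all the applicable insertions of Rule 2. *)
Definition rule2 P : {set G} :=
  P :|: [set w | [exists v in P, [set x | edge v x & x \notin P] == [set w]]].

(* A round that changes nothing ends the process, so #|G| rounds exhaust it. *)
Definition power_dominated S : {set G} := iter #|G| rule2 (rule1 S).

Definition power_dominates S : bool := power_dominated S == [set: G].

Lemma power_dominatesT : power_dominates [set: G].
Proof.
apply/eqP; apply/setP => v; rewrite inE /power_dominated.
by elim: #|G| => [|k IH] /=; rewrite !inE // IH.
Qed.

(* Minimum size of a power dominating set; the default [set: G] is feasible by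
   [power_dominatesT]. *)
Definition pds_opt : nat :=
  #|[arg min_(S < [set: G] | power_dominates S) #|S|]|.

Definition strong_region S (Q : {set G}) : bool :=
  ~~ (Q \subset power_dominated (S :|: nbr Q)).

End PowerDomination.

Section Trees.
Variable T : graph.
Implicit Types (i j k r q x : T).

(* A closed walk without repeated vertices is a cycle when it has length at
   least 3; [:: x; y] only goes back and forth along an edge. *)
Definition is_tree : Prop :=
  [/\ 0 < #|T|,
      forall i j, connect edge i j
    & forall c : seq T, ucycleb edge c -> size c < 3].

Definition on_path i k j : Prop :=
  exists p : seq T,
    [/\ path edge i p, uniq (i :: p), last i p = k & j \in i :: p].

(* Least length of a walk from i to j (#|T| if there is none). *)
Definition dist i j : nat :=
  find (fun l => [exists p : l.-tuple T, path edge i p && (last i p == j)])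
       (iota 0 #|T|).

Definition child r : rel T :=
  [rel p c | edge p c && (dist r c == (dist r p).+1)].

Definition subtree r q : {set T} := [set x | connect (child r) q x].

Definition height r : nat := \max_(q : T) dist r q.

End Trees.

Section TreeDecomposition.
Variables (G T : graph) (X : T -> {set G}).

Definition tree_decomposition : Prop :=
  [/\ is_tree T,
      \bigcup_(i : T) X i = [set: G],
      forall u v : G, edge u v -> exists i : T, (u \in X i) && (v \in X i)
    & forall i j k : T, on_path i k j -> X i :&: X k \subset X j].

Definition td_width : int := ((\max_(i : T) #|X i|)%:Z - 1)%R.

Definition subtree_union (r q : T) : {set G} :=
  \bigcup_(x in subtree r q) X x.

(* The algorithm leaves the order of the nodes within one level unspecified:
   ord l is the order in which the nodes at distance l from r are treated. *)
Definition level_order (r : T) (ord : nat -> seq T) : Prop :=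
  forall l, perm_eq (ord l) (enum [set q : T | dist r q == l]).

Definition pds_step (r : T) (S : {set G}) (q : T) : {set G} :=
  if strong_region S (subtree_union r q) then S :|: X q else S.

Definition pds_algorithm (r : T) (ord : nat -> seq T) : {set G} :=
  foldl (fun S l => foldl (pds_step r) S (ord l)) finset.set0
        (rev (iota 0 (height r).+1)).

End TreeDecomposition.

(* Main.v *)
(** Let Y_q be the union of the bags below q, and Z an optimal solution.  Rule 2
    acts locally: what happens inside a region depends on the outside only
    through the edges leaving it.  In a rooted tree the only edge leaving the
    subtree of q is the one to its parent, so every vertex of Y_q with a
    neighbour outside Y_q lies in X_q and in the bag of the parent of q.  Hence
    once the regions of the children of q are no longer strong, adding X_q to S
    makes S observe the closed neighbourhood of Y_q.

    If U is the union of the regions Y_q for which X_q was bought so far, then S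
    observes the closed neighbourhood of U; if Z met the next strong region only
    inside U, locality would let S observe that region too.  So each purchase,
    of cost at most width + 1, enlarges Z :&: U, and the algorithm spends at most
    (width + 1) |Z|.  At the end Y_r, the whole graph, is not strong, which
    means that S power dominates. *)

Require Import Defs.
From mathcomp Require Import all_boot all_order all_algebra.
Set Implicit Arguments.
Unset Strict Implicit.
Unset Printing Implicit Defensive.

(** * Power domination *)

Section PowerDominationTheory.
Variable G : graph.
Implicit Types (A B Q S U Y : {set G}) (u v x : G).

Lemma mem_rule1 S v :
  (v \in rule1 S) = (v \in S) || [exists u in S, edge u v].
Proof. by rewrite !inE; case: (v \in S). Qed.

Lemma sub_rule1 S : S \subset rule1 S.
Proof. exact: subsetUl. Qed.

Lemma rule1_edge S u v : u \in S -> edge u v -> v \in rule1 S.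
Proof.
by move=> uS uv; rewrite mem_rule1; apply/orP; right; apply/existsP;
  exists u; rewrite uS.
Qed.

Lemma rule1S A B : A \subset B -> rule1 A \subset rule1 B.
Proof.
move=> /subsetP AB; apply/subsetP => v; rewrite mem_rule1.
case/orP => [/AB vB|/existsP[u /andP[/AB uB uv]]]; last exact: rule1_edge uv.
by rewrite mem_rule1 vB.
Qed.

Lemma rule1U A B : rule1 (A :|: B) = rule1 A :|: rule1 B.
Proof.
apply/eqP; rewrite eqEsubset subUset.
rewrite (rule1S (subsetUl A B)) (rule1S (subsetUr A B)) !andbT.
apply/subsetP => v; rewrite mem_rule1 in_setU.
rewrite in_setU; case/orP => [/orP[]|/existsP[u /andP[+ uv]]].
- by move/(subsetP (sub_rule1 _)) ->.
- by move/(subsetP (sub_rule1 _)) ->; rewrite orbT.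
rewrite in_setU.
by case/orP => uS; rewrite (rule1_edge uS uv) ?orbT.
Qed.

Lemma sub_rule2 S : S \subset rule2 S.
Proof. exact: subsetUl. Qed.

Lemma iter_rule2_sub S n : S \subset iter n (@rule2 G) S.
Proof.
by elim: n => //= n IH; apply: subset_trans (sub_rule2 _).
Qed.

Lemma rule1_power_dominated S : rule1 S \subset power_dominated S.
Proof. exact: iter_rule2_sub. Qed.

Lemma sub_power_dominated S : S \subset power_dominated S.
Proof. exact: subset_trans (sub_rule1 _) (rule1_power_dominated _). Qed.

(** Each round before stabilization gains a vertex, so [#|G|] rounds are enough. *)
Lemma power_dominated_closed S : rule2 (power_dominated S) = power_dominated S.
Proof.
rewrite /power_dominated; set P := fun n => iter n (@rule2 G) (rule1 S).
have H n : rule2 (P n) = P n \/ n < #|P n.+1|.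
  elim: n => [|n [IH|IH]].
  - have [->|/eqP ne] := eqVneq (rule2 (P 0)) (P 0); [by left|right].
    rewrite (@leq_trans #|P 0|.+1) //; apply: proper_card.
    by rewrite properEneq eq_sym sub_rule2 andbT; apply/eqP.
  - by left; rewrite /P /= -/(P n) !IH.
  - have [|/eqP ne] := eqVneq (rule2 (P n.+1)) (P n.+1); [by left|right].
    apply: (leq_ltn_trans IH); apply: proper_card.
    by rewrite properEneq eq_sym sub_rule2 andbT; apply/eqP.
by case: (H #|G|) => // /leq_trans /(_ (max_card _)); rewrite ltnn.
Qed.

Lemma rule2_closed_force Q v w : rule2 Q \subset Q -> v \in Q -> edge v w ->
  (forall x, edge v x -> x != w -> x \in Q) -> w \in Q.
Proof.
move=> /subsetP cQ vQ vw H; apply: contraT => wQ.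
case/negP: (wQ); apply: cQ; rewrite !inE; apply/orP; right.
apply/existsP; exists v; rewrite vQ /=; apply/eqP/setP => x; rewrite !inE.
have [->|xw] := eqVneq x w; first by rewrite vw.
by apply/negbTE/nandP; case vx: (edge v x); [right; rewrite negbK H|left].
Qed.

(* Propagation inside Y only sees the outside through the edges leaving Y, so
   observing both ends of those edges makes the outside irrelevant. *)
Lemma power_dominated_local A Y Q :
  rule2 Q \subset Q -> rule1 A :&: Y \subset Q ->
  (forall u v, u \in Y -> v \notin Y -> edge u v -> (u \in Q) && (v \in Q)) ->
  power_dominated A :&: Y \subset Q.
Proof.
move=> cQ AQ bQ; rewrite /power_dominated; elim: #|G| => //= n.
set P := iter n _ _ => /subsetP IH.
have {}IH z : z \in P -> z \in Y -> z \in Q.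
  by move=> zP zY; apply: IH; rewrite !inE zP.
apply/subsetP => w; rewrite inE => /andP[+ wY]; rewrite !inE.
case/orP => [wP|/existsP[v /andP[vP /eqP E]]]; first exact: IH.
have vE x : edge v x -> x != w -> x \in P.
  by move=> vx; apply: contraNT => xP; rewrite -in_set1 -E !inE vx.
have vw : edge v w by have := set11 w; rewrite -E inE => /andP[].
have [vY|vY] := boolP (v \in Y); last first.
  by rewrite edge_sym in vw; case/andP: (bQ _ _ wY vY vw).
apply: (rule2_closed_force cQ (IH _ vP vY) vw) => x vx /(vE x vx) xP.
have [xY|xY] := boolP (x \in Y); first exact: IH.
by case/andP: (bQ _ _ vY xY vx).
Qed.

(** Locality with [Y] the whole vertex set, which no edge leaves. *)
Lemma power_dominatedS A B :
  A \subset B -> power_dominated A \subset power_dominated B.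
Proof.
move=> AB; rewrite -[power_dominated A]setIT.
apply: power_dominated_local => [||u v]; rewrite ?inE //.
  by rewrite power_dominated_closed.
rewrite setIT.
exact: subset_trans (rule1S AB) (rule1_power_dominated _).
Qed.

Lemma mem_nbr Y u v : u \in Y -> v \notin Y -> edge u v -> v \in nbr Y.
Proof.
by move=> uY vY uv; rewrite !inE vY; apply/existsP; exists u; rewrite uY.
Qed.

Lemma strong_regionS A B Y :
  A \subset B -> strong_region B Y -> strong_region A Y.
Proof.
move=> AB; apply: contra => /subset_trans; apply.
exact/power_dominatedS/setSU.
Qed.

(* Although nbr Y may be used as seeds, a separator B made of the vertices of Y
   with a neighbour outside is just as good inside Y. *)
Lemma weak_region_sub S B Y : ~~ strong_region S Y ->
  (forall u v, u \in Y -> v \notin Y -> edge u v -> u \in B) ->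
  Y \subset power_dominated (S :|: B).
Proof.
rewrite negbK => YS YB; set Q := power_dominated _.
have SBQ v : v \in rule1 (S :|: B) -> v \in Q.
  exact/subsetP/rule1_power_dominated.
have inB v : v \in B -> v \in Q.
  by move=> vB; apply: SBQ; rewrite mem_rule1 inE vB orbT.
have bQ u v : u \in Y -> v \notin Y -> edge u v -> (u \in Q) && (v \in Q).
  move=> uY vY uv; have uB := YB _ _ uY vY uv; rewrite inB //=.
  by apply: SBQ; apply: rule1_edge uv; rewrite inE uB orbT.
suff : power_dominated (S :|: nbr Y) :&: Y \subset Q.
  by apply: subset_trans; rewrite subsetI YS /=.
apply: power_dominated_local => //; first by rewrite power_dominated_closed.
(* A vertex of [Y] that Rule 1 observes from [nbr Y] has a neighbour outside [Y], so it lies in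
   [B]. *)
apply/subsetP => v; rewrite rule1U 2!inE => /andP[/orP[vS|vN] vY].
  by apply: SBQ; rewrite rule1U inE vS.
move: vN; rewrite mem_rule1 => /orP[|/existsP[u /andP[]]].
  by rewrite !inE vY.
rewrite !inE => /andP[uY _]; rewrite edge_sym => vu.
exact: inB (YB _ _ vY uY vu).
Qed.

(* What the optimum Z sees of Y is already observed if its seeds in Y all lie in
   a set whose closed neighbourhood is observed. *)
Lemma strong_region_witness S U Y Z : power_dominates Z ->
  rule1 U \subset power_dominated S -> strong_region S Y ->
  exists2 z, z \in Z :&: Y & z \notin U.
Proof.
move=> /eqP domZ /subsetP US strongY; apply/exists_inP.
apply: contraR strongY => /exists_inPn ZU; set Q := power_dominated _.
have SQ v : v \in power_dominated S -> v \in Q.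
  exact/subsetP/power_dominatedS/subsetUl.
have NQ v : v \in rule1 (nbr Y) -> v \in Q.
  move=> vN; apply: (subsetP (rule1_power_dominated _)).
  by rewrite rule1U inE vN orbT.
have bQ u v : u \in Y -> v \notin Y -> edge u v -> (u \in Q) && (v \in Q).
  move=> uY vY uv; have vN := mem_nbr uY vY uv.
  apply/andP; split; apply: NQ; last exact: (subsetP (sub_rule1 _)).
  by apply: rule1_edge vN _; rewrite edge_sym.
rewrite -[Y]setTI -domZ; apply: power_dominated_local => //.
  by rewrite power_dominated_closed.
have inU z : z \in Z -> z \in Y -> z \in U.
  by move=> zZ zY; rewrite -[_ \in U]negbK ZU // inE zZ.
apply/subsetP => v; rewrite inE mem_rule1 => /andP[+ vY].
case/orP => [vZ|/existsP[u /andP[uZ uv]]].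
  exact/SQ/US/(subsetP (sub_rule1 _))/inU.
have [uY|uY] := boolP (u \in Y); first exact/SQ/US/(rule1_edge (inU _ uZ uY)).
by rewrite edge_sym in uv; case/andP: (bQ _ _ vY uY uv).
Qed.

End PowerDominationTheory.

(** * Rooted trees *)

Section TreeTheory.
Variable T : graph.
Implicit Types (a b c i j p q r x y : T) (s : seq T).

Lemma dist_le_card i j : dist i j <= #|T|.
Proof. by rewrite -[leqRHS](size_iota 0); apply: find_size. Qed.

Lemma dist_path_le i s : path edge i s -> dist i (last i s) <= size s.
Proof.
move=> is_path; have [le_s|lt_s] := leqP #|T| (size s).
  exact: leq_trans (dist_le_card _ _) le_s.
rewrite leqNgt; apply/negP => /(before_find 0) /=; rewrite nth_iota // add0n.
by move/existsP; apply; exists (in_tuple s); rewrite is_path eqxx.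
Qed.

(** A walk shortens to a simple one, of length below [#|T|], so the search in [dist] succeeds before
    its default. *)
Lemma dist_path i j : connect edge i j ->
  exists s, [/\ path edge i s, last i s = j & size s = dist i j].
Proof.
case/connectP => s0 + ->; case/shortenP => s is_path us _; set j' := last i s.
pose P l := [exists t : l.-tuple T, path edge i t && (last i t == j')].
have hasP : has P (iota 0 #|T|).
  apply/hasP; exists (size s); last first.
    by apply/existsP; exists (in_tuple s); rewrite is_path eqxx.
  rewrite mem_iota /= add0n -[_ < _]/(size (i :: s) <= #|T|).
  by rewrite -(card_uniqP us) max_card.
have ltP : find P (iota 0 #|T|) < #|T|.
  by rewrite -[ltnRHS](size_iota 0) -has_find.
have := nth_find 0 hasP; rewrite nth_iota //.
case/existsP => t /andP[it /eqP jt]; exists t; split=> //.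
by rewrite size_tuple.
Qed.

(* Closing up a path from a to b avoiding the edge ab would give a cycle. *)
Lemma tree_edge_bridge a b : is_tree T -> edge a b ->
  ~~ connect [rel x y | edge x y && ([set x; y] != [set a; b])] a b.
Proof.
case=> _ _ acyc ab; apply/negP => /connectP[s0 s0P Eb].
move: Eb; case/shortenP: s0P => s ps us _ Eb.
have {}as_ : path edge a s by apply: sub_path ps => x y /andP[].
have := acyc (a :: s); rewrite /ucycleb us /= rcons_path as_ -Eb edge_sym ab.
(* Without cycles, [s] is empty, whence [a = b], or it is the excluded edge itself. *)
move/(_ isT); case: s ps us Eb {as_} => [|y [|x s]] //= ps _ Eb _.
  by rewrite Eb edge_irr in ab.
by move: ps; rewrite -Eb eqxx andbF.
Qed.

(** * Levels, parents and subtrees *)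

Section Rooted.
Hypothesis treeT : is_tree T.
Variable r : T.

Lemma dist_edge x y : edge x y -> dist r y <= (dist r x).+1.
Proof.
move=> xy; have [_ /(_ r x) /dist_path[s [rs sx <-]] _] := treeT.
have := @dist_path_le r (rcons s y); rewrite rcons_path rs sx xy last_rcons.
by rewrite size_rcons; apply.
Qed.

(** Prefixes of a shortest path from the root are shortest, so its edges go from parent to child.
    The level bound [n] serves to show that such a path avoids a given edge. *)
Lemma connect_child_le n x : dist r x <= n ->
  connect [rel p c | child r p c && (dist r c <= n)] r x.
Proof.
move Ed: (dist r x) => d; elim: d x Ed => [|d IH] x Ed le_n.
  have [_ /(_ r x) /dist_path[s [_ sx sD]] _] := treeT.
  by move: sD; rewrite Ed -sx => /size0nil ->.
have [_ /(_ r x) /dist_path[s [rs sx sD]] _] := treeT.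
move: sD; rewrite Ed; case/lastP: s rs sx => // s y.
rewrite rcons_path last_rcons size_rcons => /andP[rs sy] Ey [Es].
rewrite {y}Ey in sy.
have Dp : dist r (last r s) = d.
  apply/eqP; rewrite eqn_leq -[X in _ <= X]Es dist_path_le //=.
  by rewrite -ltnS -Ed dist_edge.
apply: connect_trans (IH _ Dp (ltnW le_n)) (connect1 _).
by rewrite /child /= sy Ed Dp eqxx.
Qed.

Lemma subtree_root : subtree r r = [set: T].
Proof.
apply/setP => x; rewrite !inE.
apply: connect_sub (connect_child_le (leqnn (dist r x))) => p c /andP[pc _].
exact: connect1.
Qed.

(** The descent to [x] uses only edges between consecutive levels up to [n]; the edge [ab] stays on
    one level or reaches below [n]. *)
Lemma connect_child_avoid n a b x :
  (dist r a == dist r b) || (n < maxn (dist r a) (dist r b)) -> dist r x <= n ->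
  connect [rel x y | edge x y && ([set x; y] != [set a; b])] r x.
Proof.
move=> Hab le_n; apply: connect_sub (connect_child_le le_n) => p c.
case/andP => /andP[pc /eqP Dc] le_c; apply: connect1; rewrite /= pc /=.
apply: contraTneq Hab => E.
have : (a \in [set p; c]) && (b \in [set p; c]) by rewrite E !inE !eqxx orbT.
have : (p \in [set a; b]) && (c \in [set a; b]) by rewrite -E !inE !eqxx orbT.
have pNc : p != c by apply: contraTneq pc => ->; rewrite edge_irr.
rewrite !inE => /andP[/orP[]/eqP Ep /orP[]/eqP Ec _]; move: pNc le_c Dc;
  rewrite Ep Ec ?eqxx // => _; rewrite negb_or -leqNgt geq_max.
  move=> le_c Dc; have lt_n : dist r a < n by rewrite -Dc.
  by rewrite (ltnW lt_n) le_c Dc neq_ltn ltnSn.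
move=> le_c Dc; have lt_n : dist r b < n by rewrite -Dc.
by rewrite (ltnW lt_n) le_c Dc neq_ltn ltnSn orbT.
Qed.

Lemma avoid_connect_sym a b :
  connect_sym [rel x y | edge x y && ([set x; y] != [set a; b])].
Proof. by apply: sym_connect_sym => x y /=; rewrite edge_sym setUC. Qed.

(** If both ends were on one level, descents from the root would join them without their edge, which
    is a bridge. *)
Lemma edge_child x y : edge x y -> child r x y || child r y x.
Proof.
move=> xy; have yx : edge y x by rewrite edge_sym.
have [lt|gt|E] := ltngtP (dist r x) (dist r y).
- by rewrite /child /= xy eqn_leq dist_edge // lt.
- by rewrite orbC /child /= yx eqn_leq dist_edge // gt.
have avoid z : dist r z <= dist r x ->
    connect [rel u v | edge u v && ([set u; v] != [set x; y])] r z.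
  by apply: connect_child_avoid; rewrite E eqxx.
case/negP: (tree_edge_bridge treeT xy).
apply: connect_trans (avoid y _); last by rewrite E.
by rewrite avoid_connect_sym avoid.
Qed.

(** A second parent would give a detour from [p] through the root to [c], around the bridge [pc]. *)
Lemma parent_unique p p' c : child r p c -> child r p' c -> p = p'.
Proof.
move=> /andP[pc /eqP Dp] /andP[p'c /eqP Dp']; apply/eqP; apply: contraT => ne.
have avoid z : dist r z <= dist r p ->
    connect [rel u v | edge u v && ([set u; v] != [set p; c])] r z.
  by apply: connect_child_avoid; rewrite leq_max Dp leqnn !orbT.
case/negP: (tree_edge_bridge treeT pc).
apply: (@connect_trans _ _ r); first by rewrite avoid_connect_sym avoid.
have Epp' : dist r p = dist r p' by case: (etrans (esym Dp) Dp').
apply: connect_trans (avoid p' _) (connect1 _); first by rewrite Epp'.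
rewrite /= p'c /=; apply: contraNneq ne => E.
have := set21 p c; rewrite -E !inE => /orP[//|/eqP Epc].
by rewrite Epc edge_irr in pc.
Qed.

Lemma connect_child_last c x : connect (child r) c x -> c = x \/
  exists2 p, connect (child r) c p & child r p x.
Proof.
case/connectP => s; case/lastP: s => [|s y] cs ->; first by left.
right; rewrite last_rcons; move: cs; rewrite rcons_path => /andP[cs sy].
by exists (last c s) => //; apply/connectP; exists s.
Qed.

Lemma subtree_exit_edge c a b : a \in subtree r c -> b \notin subtree r c ->
  edge a b -> a = c /\ child r b c.
Proof.
rewrite !inE => ca cb /edge_child/orP[ab|ba].
  by case/negP: cb; apply: connect_trans ca (connect1 ab).
case: (connect_child_last ca) => [->//|[p cp pa]].
by case/negP: cb; rewrite (parent_unique ba pa).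
Qed.

Lemma path_exit (D : {set T}) x s : path edge x s -> x \in D ->
  last x s \notin D -> exists a b,
  [/\ a \in D, b \notin D, edge a b, a \in x :: s & b \in x :: s].
Proof.
elim: s x => [|y s IH] x /=; first by move=> _ ->.
case/andP => xy ys xD lD; have [yD|yD] := boolP (y \in D); last first.
  by exists x, y; rewrite !inE !eqxx orbT.
have [a [b [aD bD ab a_s b_s]]] := IH y ys yD lD.
by exists a, b; split; rewrite // inE ?a_s ?b_s orbT.
Qed.

(* The path from inside the subtree of c to the outside runs through c and then
   through the parent of c. *)
Lemma on_path_exit c x y : x \in subtree r c -> y \notin subtree r c ->
  on_path x y c /\ forall q, child r q c -> on_path x y q.
Proof.
move=> xc yc; have [_ /(_ x y) /connectP[s0 s0P Ey] _] := treeT.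
move: yc; rewrite {}Ey; case/shortenP: s0P => s xs us _ yc.
have [a [b [ac bc ab a_s b_s]]] := path_exit xs xc yc.
have [Ea bP] := subtree_exit_edge ac bc ab.
split=> [|q qc]; exists s; split=> //; first by rewrite -Ea.
by rewrite (parent_unique qc bP).
Qed.

End Rooted.
End TreeTheory.

(** * The approximation algorithm *)

Section Algorithm.
Variables (G T : graph) (X : T -> {set G}) (r : T).
Hypothesis tdX : tree_decomposition X.
Implicit Types (q c : T) (u v : G) (S : {set G}).
Notation Y := (subtree_union X r).

Lemma subtree_union_root : Y r = [set: G].
Proof.
have [treeT coverX _ _] := tdX; rewrite -coverX /subtree_union subtree_root //.
by apply: eq_bigl => x; rewrite inE.
Qed.

(** A bag holding both [u] and [v] is outside the subtree, so the tree path to it from a bag of [u]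
    below [c] passes through [c] and its parent. *)
Lemma subtree_union_boundary c u v :
  u \in Y c -> v \notin Y c -> edge u v ->
  u \in X c /\ forall q, child r q c -> u \in X q.
Proof.
have [treeT _ edgeX pathX] := tdX; case/bigcupP => x xc ux vY uv.
have [i /andP[ui vi]] := edgeX _ _ uv.
have ic : i \notin subtree r c.
  by apply: contraNN vY => ic; apply/bigcupP; exists i.
have [xic xiq] := on_path_exit treeT xc ic.
have sub j : on_path x i j -> u \in X j.
  by move=> /pathX /subsetP; apply; rewrite inE ux.
by split=> [|q /xiq]; apply: sub.
Qed.

Lemma subtree_union_child q v : v \in Y q ->
  v \in X q \/ exists2 c, child r q c & v \in Y c.
Proof.
case/bigcupP => x; rewrite inE => /connectP[[|c s] /= qs ->] vx; first by left.
case/andP: qs => qc cs; right; exists c => //; apply/bigcupP.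
by exists (last c s) => //; rewrite inE; apply/connectP; exists s.
Qed.

(** The boundary of each child region lies in [X q], which therefore replaces the seeds around that
    region. *)
Lemma subtree_union_dominated S q :
  (forall c, child r q c -> ~~ strong_region S (Y c)) ->
  Y q \subset power_dominated (S :|: X q).
Proof.
move=> weak; apply/subsetP => v /subtree_union_child[vX|[c qc vc]].
  by apply: (subsetP (sub_power_dominated _)); rewrite inE vX orbT.
apply: subsetP vc; apply: weak_region_sub (weak _ qc) _ => u x uY xY ux.
by have [_ /(_ _ qc)] := subtree_union_boundary uY xY ux.
Qed.

Lemma subtree_union_rule1 S q :
  (forall c, child r q c -> ~~ strong_region S (Y c)) ->
  rule1 (Y q) \subset power_dominated (S :|: X q).
Proof.
move=> /subtree_union_dominated /subsetP domY; apply/subsetP => v.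
have [/domY //|vY] := boolP (v \in Y q).
rewrite mem_rule1 (negbTE vY) /= => /existsP[u /andP[uY uv]].
apply: (subsetP (rule1_power_dominated _)); apply: (@rule1_edge _ _ u) => //.
by rewrite inE; have [-> _] := subtree_union_boundary uY vY uv; rewrite orbT.
Qed.

(** * Charging the purchases to a power dominating set *)

Variable Z : {set G}.
Hypothesis domZ : power_dominates Z.
Notation k := (\max_(i : T) #|X i|).

(* U is the union of the regions at which the algorithm bought a bag: every
   purchase enlarges Z :&: U. *)
Definition algorithm_inv (D : pred T) S : Prop :=
  (forall q, D q -> ~~ strong_region S (Y q)) /\
  exists2 U, rule1 U \subset power_dominated S & #|S| <= k * #|Z :&: U|.

Lemma algorithm_inv_step (D : pred T) S q :
  (forall c, child r q c -> D c) -> algorithm_inv D S ->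
  algorithm_inv [predU1 q & D] (pds_step X r S q).
Proof.
move=> Dq [weak [U domU leS]]; rewrite /pds_step.
case: ifPn => [strong|weakq]; last first.
  by split=> [x /predU1P[->|/weak]|] //; exists U.
have domY := subtree_union_rule1 (fun c qc => weak c (Dq c qc)).
have subS : S \subset S :|: X q by apply: subsetUl.
split=> [x /predU1P[->|/weak]|]; last 1 first.
(* The purchase is charged to [z]: it joins [Z :&: U] when [U] grows by [Y q], and the new multiple
   of [k] pays for [X q]. *)
- have [z] := strong_region_witness domZ domU strong; rewrite inE.
  case/andP => zZ zY zU; exists (U :|: Y q).
    by rewrite rule1U subUset domY (subset_trans domU) ?power_dominatedS.
  have : #|Z :&: U| < #|Z :&: (U :|: Y q)|.
    apply: proper_card; rewrite properE setIS ?subsetUl //=.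
    apply/subsetPn; exists z; first by rewrite !inE zZ zY orbT.
    by rewrite inE negb_and zU orbT.
  move/(leq_mul (leqnn k)); apply: leq_trans; rewrite mulnS addnC.
  apply: leq_trans (leq_card_setU _ _) _; rewrite leq_add //.
  exact: (leq_bigmax q).
- rewrite negbK; apply: subset_trans (sub_rule1 _) (subset_trans domY _).
  exact/power_dominatedS/subsetUl.
- by apply: contra; apply: strong_regionS.
Qed.

(** The children of all nodes in [s] are in [D] from the start, so the order within [s] is
    irrelevant. *)
Lemma algorithm_inv_level (D : pred T) S (s : seq T) :
  (forall q c, q \in s -> child r q c -> D c) -> algorithm_inv D S ->
  algorithm_inv [pred q | (q \in s) || D q] (foldl (pds_step X r) S s).
Proof.
elim: s D S => [|q s IH] D S Ds invS //=.
have [weak HU] : algorithm_inv [pred x | (x \in s) || [predU1 q & D] x]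
    (foldl (pds_step X r) (pds_step X r S q) s).
  apply: IH => [x c xs xc|].
    by apply/orP; right; apply: Ds xc; rewrite inE xs orbT.
  by apply: algorithm_inv_step => // c; apply: Ds; rewrite mem_head.
by split=> // x /=; rewrite inE -orbA orbCA => /weak.
Qed.

Lemma algorithm_inv_levels ord n S : level_order r ord ->
  algorithm_inv [pred q | n <= dist r q] S ->
  algorithm_inv predT
    (foldl (fun S l => foldl (pds_step X r) S (ord l)) S (rev (iota 0 n))).
Proof.
move=> ordP; elim: n S => [|n IH] S inv //.
rewrite -addn1 iotaD rev_cat /= add0n; apply: IH.
have ord_n q : (q \in ord n) = (dist r q == n).
  by rewrite (perm_mem (ordP n)) mem_enum inE.
have [q c|weak HU] := @algorithm_inv_level _ _ (ord n) _ inv.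
  by rewrite ord_n => /eqP Dq /andP[_ /eqP /= ->]; rewrite Dq.
split=> // q /= le_n; apply: weak => /=.
by rewrite ord_n eq_sym -leq_eqVlt.
Qed.

Lemma pds_algorithm_inv ord : level_order r ord ->
  algorithm_inv predT (pds_algorithm X r ord).
Proof.
move=> ordP; apply: algorithm_inv_levels => //; split=> [q /=|].
  (* No node is deeper than the height, so nothing is claimed weak at the start. *)
  by rewrite ltnNge /height leq_bigmax.
exists set0; last by rewrite cards0.
apply/subsetP => v; rewrite mem_rule1 inE => /existsP[u].
by rewrite inE.
Qed.

Lemma pds_algorithm_card ord : level_order r ord ->
  #|pds_algorithm X r ord| <= k * #|Z|.
Proof.
move=> /pds_algorithm_inv[_ [U _ /leq_trans]]; apply.
by rewrite leq_mul2l subset_leq_card ?orbT ?subsetIl.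
Qed.

End Algorithm.

Lemma pds_algorithm_dominates (G T : graph) (X : T -> {set G}) r ord :
  tree_decomposition X -> level_order r ord ->
  power_dominates (pds_algorithm X r ord).
Proof.
move=> tdX /(pds_algorithm_inv tdX (power_dominatesT G))[/(_ r isT) + _].
(* The root region is all of [G] and has no outer neighbours to help as seeds. *)
rewrite negbK subtree_union_root //.
have -> : nbr [set: G] = set0 by apply/setP => v; rewrite !inE.
by rewrite setU0 subTset.
Qed.

Lemma pds_algorithm_approx (G T : graph) (X : T -> {set G}) r ord :
  tree_decomposition X -> level_order r ord ->
  #|pds_algorithm X r ord| <= (\max_(i : T) #|X i|) * pds_opt G.
Proof.
move=> tdX ordP; rewrite /pds_opt.
case: arg_minnP => [|Z domZ _]; first exact: power_dominatesT.
exact: pds_algorithm_card.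
Qed.

(* Growth rate of the guarantee *)
From mathcomp Require Import all_classical all_reals topology normedtype landau.
Import Order.TTheory GRing.Theory Num.Theory numFieldNormedType.Exports.
Local Open Scope classical_set_scope.
Local Open Scope ring_scope.

Lemma sqrt_nat_bigO_add1 (R : realType) (w : nat -> R) :
  w =O_\oo (fun n : nat => Num.sqrt n%:R : R) ->
  (fun n => w n + 1) =O_\oo (fun n : nat => Num.sqrt n%:R : R).
Proof.
(* The extra 1 in [C + 1] absorbs the added constant, as [1 <= sqrt n] for positive [n]. *)
move=> /eqO_exP[C C0 wC]; apply/eqO_exP; exists (C + 1); first exact: addr_gt0.
near=> n; rewrite mulrDl mul1r (le_trans (ler_normD _ _)) // lerD //.
  by near: n.
rewrite normr1 ger0_norm ?sqrtr_ge0 // -[leLHS]sqrtr1 ler_wsqrtr // ler1n.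
near: n; exact: nbhs_infty_gt.
Unshelve. all: by end_near. Qed.

Theorem theorem4 (R : realType) (w : nat -> R)
    (hw : w =O_\oo (fun n : nat => Num.sqrt n%:R : R)) :
  exists2 rho : nat -> R,
    rho =O_\oo (fun n : nat => Num.sqrt n%:R : R) &
    forall (G T : graph) (X : T -> {set G}) (r : T) (ord : nat -> seq T),
      planar R G ->
      tree_decomposition X ->
      (td_width X)%:~R <= w #|G| ->
      level_order r ord ->
      power_dominates (pds_algorithm X r ord) /\
      #|pds_algorithm X r ord|%:R <= rho #|G| * (pds_opt G)%:R.
Proof.
(* The factor is the largest bag size, one more than the width. *)
exists (fun n => w n + 1); first exact: sqrt_nat_bigO_add1.
move=> G T X r ord _ tdX widthX ordP; split.
  exact: pds_algorithm_dominates.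
have := pds_algorithm_approx tdX ordP; rewrite -(ler_nat R) natrM.
move=> /le_trans; apply; rewrite ler_wpM2r // -lerBlDr.
by move: widthX; rewrite /td_width rmorphB.
Qed.
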